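(* Let $k\geq 2$ be an integer and let $S$ be a spider of order $2k+2$ with $r$ odd legs and $s$ legs of length $1$. If $r\geq 2$ and $2s-r\geq 1$, then for all sufficiently large $n$, every graph $G$ of order $n$ with $\mu(G)\geq \mu(S_{n,k})$ contains $S$ as a subgraph.
   Context: All graphs are finite, simple and undirected. The order of a graph is its number of vertices. $\mu(G)$ denotes the spectral radius of $G$, i.e. the largest eigenvalue of its adjacency matrix. ''Contains as a subgraph'' means a not necessarily induced subgraph (up to isomorphism). $S_{n,k}=K_k\vee\overline{K_{n-k}}$ is the graph of order $n$ obtained by joining every vertex of a complete graph $K_k$ to every vertex of an independent set of order $n-k$. A spider is a tree with at most one vertex of degree more than $2$; that vertex is called the center (if there is no such vertex, so the spider is a path, any designated vertex can act as the center). A leg of a spider is a path from the center to a vertex of degree $1$; the length of a leg is its number of edges; an odd leg is a leg of odd length (so legs of length $1$ are counted among the odd legs). ''Sufficiently large $n$'' means $n\ge n_0$ for some threshold $n_0$ depending only on $k$ and $S$. *)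

(* Defs.v *)
From HB Require Import structures.
From mathcomp Require Import all_boot all_order all_algebra.
From mathcomp Require Import classical_sets reals.

Set Implicit Arguments.
Unset Strict Implicit.
Unset Printing Implicit Defensive.

Import Order.TTheory GRing.Theory Num.Theory.

Record sgraph := SGraph {
  svertex :> finType;
  sedge : rel svertex;
  sedge_sym : symmetric sedge;
  sedge_irrefl : irreflexive sedge }.

Definition degree (G : sgraph) (x : G) : nat := #|[set y | sedge x y]|.

Definition contains_subgraph (G H : sgraph) : Prop :=
  exists f : H -> G,
    injective f /\ forall x y : H, sedge x y -> sedge (f x) (f y).

Definition complete_rel (n : nat) : rel 'I_n := fun i j => i != j.

Fact complete_sym n : symmetric (@complete_rel n).
Proof. by move=> i j; rewrite /complete_rel eq_sym. Qed.

Fact complete_irrefl n : irreflexive (@complete_rel n).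
Proof. by move=> i; rewrite /complete_rel eqxx. Qed.

Definition complete (n : nat) : sgraph :=
  SGraph (@complete_sym n) (@complete_irrefl n).

Definition compl_rel (G : sgraph) : rel G :=
  fun x y => (x != y) && ~~ sedge x y.

Fact compl_sym G : symmetric (@compl_rel G).
Proof. by move=> x y; rewrite /compl_rel eq_sym sedge_sym. Qed.

Fact compl_irrefl G : irreflexive (@compl_rel G).
Proof. by move=> x; rewrite /compl_rel eqxx. Qed.

Definition compl (G : sgraph) : sgraph :=
  SGraph (@compl_sym G) (@compl_irrefl G).

Definition join_rel (G H : sgraph) : rel (G + H)%type :=
  fun u v => match u, v with
             | inl x, inl y => sedge x y
             | inr x, inr y => sedge x y
             | _, _ => true
             end.

Fact join_sym G H : symmetric (@join_rel G H).
Proof. by case=> x [] y //=; rewrite sedge_sym. Qed.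

Fact join_irrefl G H : irreflexive (@join_rel G H).
Proof. by case=> x /=; rewrite sedge_irrefl. Qed.

Definition join (G H : sgraph) : sgraph :=
  SGraph (@join_sym G H) (@join_irrefl G H).

(* This has order n only when k <= n. *)
Definition Snk (n k : nat) : sgraph := join (complete k) (compl (complete (n - k))).

Definition adjacency (R : realType) (G : sgraph) : 'M[R]_#|G| :=
  \matrix_(i, j) (sedge (enum_val i) (enum_val j))%:R%R.

(* The set of eigenvalues is finite, and it is nonempty if G has a vertex
   because the matrix is real symmetric; so the supremum is a maximum. *)
Definition spectral_radius (R : realType) (G : sgraph) : R :=
  sup [set a : R | eigenvalue (adjacency R G) a]%classic.

(* In ucycle, the closing edge is implicit; an edge gives a ucycle of size 2. *)
Definition acyclic (G : sgraph) : Prop :=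
  forall p : seq G, ucycle (@sedge G) p -> size p < 3.

Definition connected (G : sgraph) : Prop :=
  0 < #|G| /\ forall x y : G, connect (@sedge G) x y.

Definition is_tree (G : sgraph) : Prop := connected G /\ acyclic G.

Definition is_spider (G : sgraph) : Prop :=
  is_tree G /\ #|[set v : G | 2 < degree v]| <= 1.

(* If no vertex has degree more than 2, every vertex qualifies. *)
Definition is_center (G : sgraph) (c : G) : Prop :=
  forall v : G, 2 < degree v -> v = c.

(* A leg is encoded by the sequence p of its vertices other than the center c,
   so that size p is its length. *)
Definition is_leg (G : sgraph) (c : G) (p : seq G) : bool :=
  [&& 0 < size p, path (@sedge G) c p, uniq (c :: p)
    & degree (last c p) == 1].

(* Bounded sequences lose no leg, since uniq (c :: p) forces size p < #|G|. *)
Definition num_odd_legs (G : sgraph) (c : G) : nat :=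
  #|[set p : #|G|.-bseq G | is_leg c p && odd (size p)]|.

Definition num_legs_of_length (G : sgraph) (c : G) (l : nat) : nat :=
  #|[set p : #|G|.-bseq G | is_leg c p && (size p == l)]|.

(* Main.v *)
Require Import Defs.
From mathcomp Require Import all_boot all_order all_algebra.
From mathcomp Require Import boolp classical_sets reals.
From mathcomp Require Import fintype boot.finset.
From mathcomp Require Import zify ring lra.

(** Root the spider [S] at its center [c] and split its vertices by the parity
of their depth. A vertex other than [c] has at most one child, so passing to
the parent maps the even vertices other than [c] injectively to odd vertices
that are not leaves, while each odd leg ends in its own odd leaf. With at least
two odd legs the odd vertices therefore outnumber the even ones, and since
there are [2 * k + 2] vertices in all, at most [k] of them are even
([odd_level_large]).

Hence [S] can be embedded greedily, one vertex at a time away from the root,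
into any bipartite graph whose first side has degrees at least [2 * k + 2] and
whose second side has degrees at least [k]: even vertices go to the first side,
where they never exhaust the [k] neighbours of an already placed odd vertex
([greedy_embedding]). Peeling off vertices of small degree shows that a graph
without [S] has at most [(k - 1) * #|W| + (2 * k + 2) * #|U|] edges between
disjoint sets [U] and [W], and, by the same argument without bipartiteness, at
most linearly many edges altogether ([free_edge_bound]).

Let [a] be an eigenvalue of such a graph of order [n], with an eigenvector [x]
whose largest entry has absolute value [1]. Counting walks of length two from
that entry gives [a ^+ 2 <= \sum_u degree u * `|x u|]. The vertices with small
[`|x u|] contribute little, because the graph is sparse. The others form a set
[L] of size [O(n / a)], since [a * `|x u| <= degree u]; when [a] is large, [L]
is negligible next to [n], and its degree sum is at most [(k - 1) * n] plus a
negligible term. Thus [a ^+ 2 <= (k - 1/4) * n] ([sparse_eigenvalue_bound]),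
whereas the square of the spectral radius of [Snk n k] is at least
[k * (n - k)] ([spectral_radius_Snk]). The gap between the leading constants
[k - 1/4] and [k] is a contradiction for large [n]. *)

Set Implicit Arguments.
Unset Strict Implicit.
Unset Printing Implicit Defensive.

Import Order.TTheory GRing.Theory Num.Theory.

(** * Trees rooted at a vertex *)

Definition rooting (S : sgraph) (c : S) (par : S -> S) (depth : S -> nat) : Prop :=
  [/\ depth c = 0,
      forall v, v != c -> sedge v (par v) /\ depth v = (depth (par v)).+1
    & forall u v, sedge u v ->
        (u != c /\ par u = v) \/ (v != c /\ par v = u)].

(** Depth is the distance to [c] and [par v] is any neighbour of [v] nearer to
[c]. An edge that is not of parent type would close a cycle together with the
path between its ends that runs along parent edges, so in an acyclic graph
there is none. *)
Lemma tree_rooting (S : sgraph) (c : S) :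
  is_tree S -> exists par depth, @rooting S c par depth.
Proof.
move=> [[_ conn] acy].
have walk v : exists n,
    [exists p : n.-tuple S, path (@sedge S) c p && (last c p == v)].
  case/connectP: (conn c v) => p pth ->; exists (size p).
  by apply/existsP; exists (in_tuple p); rewrite pth /=.
pose depth v := ex_minn (walk v).
have depth_le p : path (@sedge S) c p -> depth (last c p) <= size p.
  move=> pth; rewrite /depth; case: ex_minnP => m _; apply.
  by apply/existsP; exists (in_tuple p); rewrite pth /=.
have depth_path v : exists2 p, path (@sedge S) c p & last c p = v /\ size p = depth v.
  rewrite /depth; case: ex_minnP => m /existsP[p /andP[pth /eqP lst]] _.
  by exists p => //; split=> //; rewrite size_tuple.
have parP v : exists w, v != c -> sedge v w /\ depth v = (depth w).+1.
  have [p pth [lst sz]] := depth_path v.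
  case: (lastP p) pth lst sz => [_ <- _|q w]; first by exists c; rewrite eqxx.
  rewrite rcons_path last_rcons size_rcons => /andP[pq ew] wv szq.
  rewrite wv in ew; exists (last c q) => _; split; first by rewrite sedge_sym.
  have [q' pq' [lq' szq']] := depth_path (last c q).
  have le1 : depth v <= (depth (last c q)).+1.
    have := @depth_le (rcons q' v); rewrite last_rcons size_rcons szq'; apply.
    by rewrite rcons_path pq' lq'.
  by apply/eqP; rewrite eqn_leq le1 -szq ltnS depth_le.
have [par parE] := fin_all_exists parP.
have depth0 : depth c = 0.
  by apply/eqP; rewrite -leqn0; apply: (depth_le [::]).
exists par, depth; split=> // u v euv.
pose e x y := (x != c) && (par x == y) || (y != c) && (par y == x).
have e_sym : symmetric e by move=> x y; rewrite /e orbC.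
have e_sub : subrel e (@sedge S).
  move=> x y /orP[] /andP[/parE[? _] /eqP<-] //; by rewrite sedge_sym.
suff : e u v.
  by case/orP=> /andP[nc /eqP]; [left|right].
(* The ends of the edge are joined along parent edges through the root. *)
have e_root x : connect e x c.
  have [m] := ubnP (depth x); elim: m x => // m IH x ltm.
  have [->|xc] := eqVneq x c; first exact: connect0.
  have [exp dx] := parE x xc; apply: connect_trans (IH (par x) _).
    by apply: connect1; rewrite /e xc eqxx.
  by rewrite dx in ltm.
have : connect e u v.
  by apply: connect_trans (e_root u) _; rewrite (sym_connect_sym e_sym).
case/connectP=> p0 /shortenP[p pth unq _] lst.
case: p pth unq lst => [|x [|y p]] /=.
- by move=> _ _ vu; move: euv; rewrite vu sedge_irrefl.
- by rewrite andbT => exu _ ->.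
move=> pth unq lst.
(* A simple path of length at least two, closed up by the edge [u v]. *)
suff : size [:: u, x, y & p] < 3 by [].
apply: acy; apply/andP; split; last exact: unq.
have /= := @sub_path _ _ _ e_sub u [:: x, y & p] pth.
rewrite /cycle /= rcons_path => /and3P[-> -> ->] /=.
by rewrite -lst sedge_sym.
Qed.

(** A simple path from the root cannot turn back towards it, since the only
upward step from a vertex leads to the vertex just visited. So the path is
determined by its last vertex, by following parents; this is what makes
distinct legs end in distinct leaves. *)
Lemma rooted_path_traject (S : sgraph) (c : S) par depth (p : seq S) :
  rooting c par depth -> path (@sedge S) c p -> uniq (c :: p) ->
  depth (last c p) = size p /\
  rev (c :: p) = traject par (last c p) (size p).+1.
Proof.
move=> [d0 parE edgeE].
elim/last_ind: p => [|p x IH] //.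
rewrite rcons_path last_rcons size_rcons -rcons_cons rcons_uniq.
move=> /andP[pth ex] /andP[xp unq].
have [dl trj] := IH pth unq.
have [xc px] : x != c /\ par x = last c p.
  case: (edgeE _ _ ex) => // -[lc plx]; case/negP: xp.
  rewrite -mem_rev trj -plx; case: (p) lc => [|y q _]; first by rewrite eqxx.
  by rewrite /= !inE eqxx orbT.
split; first by have [_ ->] := parE x xc; rewrite px dl.
by rewrite rev_rcons trj [RHS]trajectS px.
Qed.

(** The parent map injects the even vertices other than [c] into the odd
vertices of degree at least 2, and the last vertices of the odd legs are
pairwise distinct odd vertices of degree 1. *)
Lemma odd_level_large (S : sgraph) (c : S) par depth :
  rooting c par depth -> is_center c ->
  #|[set v | ~~ odd (depth v)]| + num_odd_legs c <=
  #|[set v | odd (depth v)]|.+1.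
Proof.
move=> root ctr; have [d0 parE edgeE] := root.
set A := [set v | ~~ odd (depth v)]; set B := [set v | odd (depth v)].
pose B1 := [set v in B | degree v == 1].
have cA : c \in A by rewrite inE d0.
have Bc v : v \in B -> v != c.
  by rewrite inE => ov; apply: contraTneq ov => ->; rewrite d0.
have legs : num_odd_legs c <= #|B1|.
  rewrite /num_odd_legs; set P := [set p | _].
  rewrite -(@card_in_imset _ _ (fun p : #|S|.-bseq S => last c p) P).
    apply/subset_leq_card/subsetP => v /imsetP[p].
    rewrite !inE => /andP[/and4P[_ pth unq dg] od ->].
    by have [-> _] := rooted_path_traject root pth unq; rewrite od.
  move=> p q; rewrite !inE => /andP[/and4P[_ pp up _] _] /andP[/and4P[_ pq uq _] _] E.
  have [dp tp] := rooted_path_traject root pp up.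
  have [dq tq] := rooted_path_traject root pq uq.
  have : rev (c :: p) = rev (c :: q) by rewrite tp tq -dp -dq E.
  by move/(congr1 rev); rewrite !revK => -[/val_inj].
(* Two children and a parent would give a non-central vertex degree 3. *)
have par_inj : {in A :\ c &, injective par}.
  move=> u v; rewrite !inE => /andP[uc ou] /andP[vc ov] E; apply/eqP/negPn/negP => uv.
  have [eu du] := parE u uc; have [ev dv] := parE v vc.
  have wB : par u \in B by move: ou; rewrite du inE /= negbK.
  have wc := Bc _ wB; have [ew dw] := parE _ wc.
  case/eqP: wc; apply: ctr; rewrite /degree.
  have -> : 3 = #|[set u; v; par (par u)]|.
    rewrite setUC cardsU1 cards2 uv !inE.
    have -> // : (par (par u) == u) || (par (par u) == v) = false.
    by apply/negbTE/norP; split; apply/eqP => /(congr1 depth) D;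
      move: dw du dv; rewrite -?E D; lia.
  apply/subset_leq_card/subsetP => x; rewrite !inE -orbA => /or3P[] /eqP->.
  - by rewrite sedge_sym.
  - by rewrite E sedge_sym.
  - by [].
have AB : #|A :\ c| <= #|B :\: B1|.
  rewrite -(card_in_imset par_inj); apply/subset_leq_card/subsetP => w /imsetP[v].
  rewrite !inE => /andP[vc ov] ->; have [ev dv] := parE v vc.
  have wB : par v \in B by move: ov; rewrite dv inE /= negbK.
  have wc := Bc _ wB; have [ew dw] := parE _ wc.
  move: (wB); rewrite inE => -> /=; rewrite andbT.
  rewrite /degree gtn_eqF //.
  have -> : 2 = #|[set v; par (par v)]|.
    rewrite cards2; have -> // : v != par (par v).
    by apply/eqP => /(congr1 depth) D; move: dw dv; rewrite -D; lia.
  apply/subset_leq_card/subsetP => x; rewrite !inE => /orP[] /eqP-> //.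
  by rewrite sedge_sym.
have : #|B| = #|B1| + #|B :\: B1|.
  rewrite -(cardsID B1 B); congr (_ + _); congr #|pred_of_set _|.
  by apply/setP => x; rewrite !inE; case: odd.
have := cardsD1 c A; rewrite cA; lia.
Qed.

(** * Greedy embedding of trees and edge counting *)

Definition nbrs (G : sgraph) (x : G) (W : {set G}) : {set G} :=
  [set y in W | sedge x y].

(** Even vertices are sent to [P] and odd ones to [Q], each next vertex being
a child of one already placed. The image of an even vertex must avoid all
earlier images that lie in [P]: in general these are fewer than [#|S|], but if
[P] and [Q] are disjoint they are images of even vertices only, which permits
the smaller degree bound [m]. *)
Lemma greedy_embedding (S G : sgraph) (c : S) par depth (m : nat) (P Q : {set G}) :
  rooting c par depth ->
  P != set0 ->
  (forall x, x \in P -> #|S| <= #|nbrs x Q|) ->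
  (forall y, y \in Q -> m <= #|nbrs y P|) ->
  #|S| <= m \/ [disjoint P & Q] /\ #|[set v : S | ~~ odd (depth v)]| <= m ->
  contains_subgraph G S.
Proof.
move=> [d0 parE edgeE] /set0Pn[p0 p0P] degP degQ bigm.
pose Z (v : S) := if odd (depth v) then Q else P.
pose good (X : {set S}) (f : S -> G) :=
  [/\ c \in X,
      forall v, v \in X -> v != c -> par v \in X /\ sedge (f v) (f (par v)),
      {in X &, injective f}
    & forall v, v \in X -> f v \in Z v].
(* [good X f]: on the parent-closed set [X], [f] is a partial embedding. *)
have grow j : j < #|S| -> exists X f, good X f /\ #|X| = j.+1.
  elim: j => [_|j IH ltj].
    exists [set c], (fun=> p0); split; last by rewrite cards1.
    split=> [|v|u v|v]; rewrite ?inE //.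
    - by move=> ->.
    - by move=> /eqP-> /eqP->.
    - by move=> /eqP->; rewrite /Z d0.
  have [X [f [[cX parX injf fZ] cardX]]] := IH (ltnW ltj).
  have [v0 v0X] : exists v, v \notin X.
    apply/existsP; rewrite -negb_forall; apply: contraTN ltj => /forallP XT.
    have -> : #|S| = #|X| by apply/esym/eq_card => x; rewrite inE; exact: XT.
    by rewrite cardX ltnn.
  (* A vertex of least depth outside [X] has its parent in [X]. *)
  have [v vX vmin] := @arg_minnP _ v0 (fun v => v \notin X) depth v0X.
  have vc : v != c by apply: contraNneq vX => ->.
  have [ev dv] := parE v vc.
  have pvX : par v \in X.
    by apply: contraT => /vmin; rewrite dv ltnn.
  have cardfX : #|f @: X| < #|S|.
    by apply: leq_ltn_trans (leq_imset_card _ _) _; rewrite cardX.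
  have [y [yZ ey yX]] : exists y, [/\ y \in Z v, sedge (f (par v)) y & y \notin f @: X].
    suff : ~~ (nbrs (f (par v)) (Z v) \subset f @: X).
      case/subsetPn => y; rewrite inE => /andP[yZ ey] yX; by exists y.
    apply/negP => sub; have le1 := subset_leq_card sub.
    have par_odd : odd (depth (par v)) = ~~ odd (depth v) by rewrite dv /= negbK.
    move: (fZ _ pvX); rewrite /Z par_odd; rewrite /Z in le1 sub.
    case ov: (odd (depth v)) le1 sub => /= le1 sub fp.
      by have := degP _ fp; lia.
    have le2 := degQ _ fp.
    case: bigm => [|[dis lem]]; first by lia.
    suff : nbrs (f (par v)) P \subset f @: (X :&: [set v | ~~ odd (depth v)]).
      move/subset_leq_card/leq_trans => /(_ _ (leq_imset_card _ _)) le3.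
      have : X :&: [set v | ~~ odd (depth v)] \proper [set v | ~~ odd (depth v)].
        rewrite properE subsetIr /=; apply/subsetPn; exists v; first by rewrite inE ov.
        by rewrite inE negb_and vX.
      by move/proper_card; lia.
    apply/subsetP => y yN; have /imsetP[x xX yx] := subsetP sub _ yN.
    apply/imsetP; exists x => //; rewrite !inE xX /=.
    apply/negP => ox; move: (fZ _ xX); rewrite /Z ox -yx => yQ.
    by move: yN; rewrite inE => /andP[yP _]; rewrite (disjointFr dis yP) in yQ.
  exists (v |: X), (fun x => if x == v then y else f x); split; last first.
    by rewrite cardsU1 vX cardX.
  have nev x : x \in X -> (x == v) = false.
    by move=> xX; apply: contraNF vX => /eqP<-.
  have yf x : x \in X -> f x != y.
    by move=> xX; apply: contraNneq yX => <-; exact: imset_f.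
  split=> [|x|x x'|x].
  - by rewrite !inE cX orbT.
  - rewrite !inE => /orP[/eqP-> _|xX xc].
      by rewrite pvX orbT eqxx nev // sedge_sym.
    by have [pxX ex] := parX _ xX xc; rewrite pxX orbT !nev.
  - rewrite !inE => /orP[/eqP->|xX] /orP[/eqP->|x'X]; rewrite ?eqxx ?nev //.
    + by move/esym/eqP; rewrite (negbTE (yf _ _)).
    + by move/eqP; rewrite (negbTE (yf _ _)).
    + exact: injf.
  - rewrite !inE => /orP[/eqP->|xX]; first by rewrite eqxx.
    by rewrite nev // fZ.
have S0 : 0 < #|S| by apply/card_gt0P; exists c.
have [|X [f [[_ parX injf _] cardX]]] := grow #|S|.-1; first by rewrite ltn_predL.
have XT x : x \in X.
  suff -> : X = setT by rewrite inE.
  by apply/eqP; rewrite eqEcard subsetT cardsT cardX prednK /=.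
exists f; split=> [x y|x y exy]; first exact: injf.
case: (edgeE _ _ exy) => -[nc <-]; first by case: (parX _ (XT x) nc).
by rewrite sedge_sym; case: (parX _ (XT y) nc).
Qed.

(** Delete one at a time the vertices of [U] with at most [b] remaining
neighbours in [W] and those of [W] with at most [a] remaining neighbours in
[U]; every deletion destroys at most that many edges, and the process only
stops when [U] is exhausted. The sets [U] and [W] may overlap. *)
Lemma peeling (G : sgraph) (a b : nat) (U W : {set G}) :
  (forall P Q : {set G}, P \subset U -> Q \subset W -> P != set0 ->
     (exists2 x, x \in P & #|nbrs x Q| <= b) \/
     (exists2 y, y \in Q & #|nbrs y P| <= a)) ->
  \sum_(x in U) #|nbrs x W| <= a * #|W| + b * #|U|.
Proof.
have [N] := ubnP (#|U| + #|W|); elim: N U W => // N IH U W ltN sparse.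
have [->|U0] := eqVneq U set0; first by rewrite big_set0.
case: (sparse U W (subxx _) (subxx _) U0) => [[x xU xb]|[y yW ya]].
  rewrite (big_setD1 x) //= (cardsD1 x U) xU.
  have := IH (U :\ x) W; rewrite (cardsD1 x U) xU in ltN => /(_ _ _).
  have H1 : #|U :\ x| + #|W| < N by move: ltN; lia.
  move/(_ H1).
  have H2 : forall P Q : {set G}, P \subset U :\ x -> Q \subset W -> P != set0 ->
     (exists2 x, x \in P & #|nbrs x Q| <= b) \/
     (exists2 y, y \in Q & #|nbrs y P| <= a).
    by move=> P Q PU; apply: sparse; apply: subset_trans PU (subsetDl _ _).
  by move/(_ H2); lia.
have deg1 x : #|nbrs x W| = sedge y x + #|nbrs x (W :\ y)|.
  rewrite (cardsD1 y) inE yW [sedge x y]sedge_sym; congr (_ + #|pred_of_set _|).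
  by apply/setP => z; rewrite !inE andbA.
have -> : \sum_(x in U) #|nbrs x W| = #|nbrs y U| + \sum_(x in U) #|nbrs x (W :\ y)|.
  rewrite (eq_bigr _ (fun x _ => deg1 x)) big_split /=; congr (_ + _).
  rewrite -sum1_card [RHS]big_mkcond [LHS]big_mkcond /=.
  by apply: eq_bigr => x _; rewrite inE; case: (x \in U) => //; case: sedge.
have := IH U (W :\ y); rewrite (cardsD1 y W) yW in ltN *.
have H1 : #|U| + #|W :\ y| < N by move: ltN; lia.
move/(_ H1).
have H2 : forall P Q : {set G}, P \subset U -> Q \subset W :\ y -> P != set0 ->
   (exists2 x, x \in P & #|nbrs x Q| <= b) \/
   (exists2 y, y \in Q & #|nbrs y P| <= a).
  by move=> P Q PU QW; apply: sparse => //; apply: subset_trans QW (subsetDl _ _).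
by move/(_ H2); lia.
Qed.

(** If peeling got stuck, the remaining vertices would satisfy the degree
conditions of the greedy embedding. The coefficient of [#|W|] is the one that
matters later: for disjoint sets it may be one less than the number of even
vertices of the tree. *)
Lemma free_edge_bound (S G : sgraph) (c : S) par depth (m : nat) (U W : {set G}) :
  rooting c par depth -> ~ contains_subgraph G S ->
  #|S| <= m.+1 \/
    [disjoint U & W] /\ #|[set v : S | ~~ odd (depth v)]| <= m.+1 ->
  \sum_(x in U) #|nbrs x W| <= m * #|W| + #|S| * #|U|.
Proof.
move=> root free bigm; apply: peeling => P Q PU QW P0.
have [/exists_inP[x xP le]|/exists_inPn H1] :=
  boolP [exists x in P, #|nbrs x Q| <= #|S|]; first by left; exists x.
have [/exists_inP[y yQ le]|/exists_inPn H2] :=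
  boolP [exists y in Q, #|nbrs y P| <= m]; first by right; exists y.
case: free; apply: (@greedy_embedding S G c par depth m.+1 P Q) => //.
- by move=> x xP; have := H1 x xP; lia.
- by move=> y yQ; rewrite ltnNge H2.
case: bigm => [|[dis le]]; [by left|right]; split=> //.
exact: disjointWl PU (disjointWr QW dis).
Qed.

Lemma degree_split (G : sgraph) (x : G) (L : {set G}) :
  degree x = #|nbrs x L| + #|nbrs x (~: L)|.
Proof.
have -> : nbrs x L = [set y | sedge x y] :&: L.
  by apply/setP => y; rewrite !inE andbC.
have -> : nbrs x (~: L) = [set y | sedge x y] :\: L.
  by apply/setP => y; rewrite !inE.
by rewrite cardsID.
Qed.

(** Edges inside [L] are bounded crudely, edges leaving [L] by the sharper
bipartite estimate, so that only the latter contribute a multiple of [#|G|]. *)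
Lemma free_degree_sum (S G : sgraph) (c : S) par depth (L : {set G}) (m : nat) :
  rooting c par depth -> ~ contains_subgraph G S ->
  #|[set v : S | ~~ odd (depth v)]| <= m.+1 ->
  \sum_(x in L) degree x <= m * #|G| + 3 * #|S| * #|L|.
Proof.
move=> root free small.
rewrite (eq_bigr _ (fun x _ => degree_split x L)) big_split /=.
have inside : \sum_(x in L) #|nbrs x L| <= #|S| * #|L| + #|S| * #|L|.
  by apply: (free_edge_bound root free); left.
have across : \sum_(x in L) #|nbrs x (~: L)| <= m * #|~: L| + #|S| * #|L|.
  apply: (free_edge_bound root free); right; split=> //.
  by rewrite -setI_eq0 setICr.
have : m * #|~: L| <= m * #|G| by rewrite leq_mul2l max_card orbT.
move=> WG; apply: leq_trans (leq_add inside across) _.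
rewrite -mulnA; move: WG.
by set y := _ * #|~: L|; set g := _ * #|G|; set q := _ * #|L|; lia.
Qed.

(** * Eigenvalues of the adjacency matrix *)

Local Open Scope ring_scope.

Lemma adjacency_eigenP (R : realType) (G : sgraph) (a : R) :
  eigenvalue (adjacency R G) a <->
  exists x : G -> R, (exists u, x u != 0) /\
    forall u, \sum_(w | sedge u w) x w = a * x u.
Proof.
have sumE (x : G -> R) (u : G) : \sum_(w | sedge u w) x w =
    \sum_(i < #|G|) x (enum_val i) * (sedge (enum_val i) u)%:R.
  rewrite -(big_enum_val (A := predT) (fun w => x w * (sedge w u)%:R)) big_mkcond /=.
  by apply: eq_bigr => w _; rewrite sedge_sym; case: sedge; rewrite ?mulr1 ?mulr0.
split=> [/eigenvalueP[v va v0]|[x [[u xu] xE]]].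
  exists (fun u => v 0 (enum_rank u)); split.
    have /rV0Pn[i vi] := v0.
    by exists (enum_val i); rewrite enum_valK.
  move=> u; rewrite sumE; move/rowP/(_ (enum_rank u)): va; rewrite !mxE => <-.
  by apply: eq_bigr => i _; rewrite !mxE enum_valK enum_rankK.
apply/eigenvalueP; exists (\row_i x (enum_val i)); last first.
  by apply/rV0Pn; exists (enum_rank u); rewrite mxE enum_rankK.
apply/rowP => j; rewrite !mxE -xE sumE.
by apply: eq_bigr => i _; rewrite !mxE.
Qed.

Lemma normalized_eigenvector (R : realType) (G : sgraph) (a : R) :
  eigenvalue (adjacency R G) a ->
  exists (x : G -> R) (z : G), [/\ `|x z| = 1, forall u, `|x u| <= 1
    & forall u, \sum_(w | sedge u w) x w = a * x u].
Proof.
case/adjacency_eigenP => x [[u0 xu0] xE].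
have [z _ zmax] := @Order.TotalTheory.arg_maxP _ _ G u0 predT (fun u => `|x u|) isT.
have xz : 0 < `|x z| by apply: lt_le_trans (zmax u0 isT); rewrite normr_gt0.
have xz0 : x z != 0 by rewrite -normr_gt0.
exists (fun u => x u / x z), z; split=> [|u|u].
- by rewrite divff // normr1.
- by rewrite normrM normfV ler_pdivrMr // mul1r; exact: zmax.
- by rewrite -mulr_suml xE mulrA.
Qed.

Lemma eigenvalue_le_order (R : realType) (G : sgraph) (a : R) :
  eigenvalue (adjacency R G) a -> a <= #|G|%:R.
Proof.
case/normalized_eigenvector => x [z [xz x1 xE]].
rewrite (le_trans (ler_norm a)) // -[`|a|]mulr1 -{1}xz -normrM -xE.
rewrite (le_trans (ler_norm_sum _ _ _)) //.
rewrite (le_trans (ler_sum _ (fun u _ => x1 u))) //.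
by rewrite sumr_const ler_nat max_card.
Qed.

Lemma eigenvalue_le_spectral_radius (R : realType) (G : sgraph) (a : R) :
  eigenvalue (adjacency R G) a -> a <= spectral_radius R G.
Proof.
move=> aG; apply: ub_le_sup => //; exists #|G|%:R => b /=.
exact: eigenvalue_le_order.
Qed.

(** Nonnegativity of [b] covers the case of an empty set of eigenvalues, whose
supremum is [0] by convention. *)
Lemma spectral_radius_le (R : realType) (G : sgraph) (b : R) :
  0 <= b -> (forall a, eigenvalue (adjacency R G) a -> a <= b) ->
  spectral_radius R G <= b.
Proof.
move=> b0 ub; rewrite /spectral_radius; set E := (X in sup X).
have [->|/set0P ne] := eqVneq E classical_sets.set0; first by rewrite sup0.
by apply: ge_sup.
Qed.

(** The partition into the clique and the independent set is equitable, so the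
vector with value [l] on the clique and [k] elsewhere is an eigenvector for the
positive root [l] of [l ^+ 2 = (k - 1) * l + k * (n - k)]. *)
Lemma spectral_radius_Snk (R : realType) (n k : nat) :
  (0 < k < n)%N ->
  exists2 l : R, 0 <= l & k%:R * (n - k)%:R <= l ^+ 2 /\
    l <= spectral_radius R (Snk n k).
Proof.
case/andP=> k0 kn.
have [j kj] : exists j, k = j.+1 by exists k.-1; rewrite prednK.
pose q : R := k%:R * (n - k)%:R.
pose l : R := (j%:R + Num.sqrt (j%:R ^+ 2 + 4 * q)) / 2.
have q0 : 0 <= q by rewrite mulr_ge0 ?ler0n.
have j0 : 0 <= j%:R :> R by rewrite ler0n.
have l0 : 0 <= l by rewrite divr_ge0 ?addr_ge0 ?sqrtr_ge0.
have lE : l ^+ 2 = j%:R * l + q.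
  have := @sqr_sqrtr R (j%:R ^+ 2 + 4 * q).
  rewrite addr_ge0 ?mulr_ge0 ?sqr_ge0 // => /(_ isT) sE.
  by rewrite /l; move: sE; set s := Num.sqrt _ => sE; lra.
exists l => //; split; first by rewrite lE -/q lerDr mulr_ge0.
apply: eigenvalue_le_spectral_radius; apply/adjacency_eigenP.
exists (fun u => match u with inl _ => l | inr _ => k%:R end); split.
  have nk : (0 < n - k)%N by rewrite subn_gt0.
  by exists (inr (Ordinal nk)); rewrite pnatr_eq0 -lt0n.
case=> [i|i]; rewrite big_sumType /= sumr_const.
- rewrite sumr_const.
  have -> : #|[pred w | complete_rel i w]| = j.
    have cardK : #|predC1 i| = k.-1 by rewrite cardC1; congr _.-1; exact: card_ord.
    have -> : j = k.-1 by rewrite kj.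
    rewrite -cardK.
    by apply: eq_card => w; rewrite !inE /complete_rel eq_sym.
  rewrite -expr2 lE /q.
  have -> : #|[pred _ : compl (complete (n - k)) | true]| = (n - k)%N by exact: card_ord.
  rewrite -[l *+ j]mulr_natl -[_ *+ (n - k)]mulr_natl; ring.
- rewrite big_pred0 => [|w]; last by rewrite /compl_rel /= /complete_rel andbN.
  have -> : #|[pred _ : complete k | true]| = k by exact: card_ord.
  by rewrite addr0 mulr_natr.
Qed.

(** The first degree hypothesis says that the graph is sparse; the second, that
sets of [o(n)] vertices have degree sum at most about [m * n]. The entries of
the eigenvector are split at the threshold [1 / (4 * D)]: the small ones then
contribute at most [n / 2], and once [a] exceeds [96 * D ^ 3] the set [L] of
the large ones is so small that its error term is at most [n / 4]. *)
Lemma sparse_eigenvalue_bound (R : realType) (G : sgraph) (D m : nat) (a : R) :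
  (0 < D)%N ->
  (\sum_(u : G) degree u <= 2 * D * #|G|)%N ->
  (forall L : {set G},
     (\sum_(u in L) degree u <= m * #|G| + 3 * D * #|L|)%N) ->
  eigenvalue (adjacency R G) a ->
  96 * D%:R ^+ 3 <= a ->
  a ^+ 2 <= (m%:R + 3 / 4) * #|G|%:R.
Proof.
move=> D0 sumdeg sumL /normalized_eigenvector[x [z [xz x1 xE]]] aD.
pose d : R := D%:R; pose N : R := #|G|%:R.
have d1 : 1 <= d by rewrite ler1n.
have d0 : 0 < d by rewrite ltr0n.
have a0 : 0 <= a by apply: le_trans aD; rewrite mulr_ge0 ?exprn_ge0 // ltW.
have N0 : 0 <= N by rewrite ler0n.
have step u : a * `|x u| <= \sum_(w | sedge u w) `|x w|.
  by rewrite -{1}(ger0_norm a0) -normrM -xE ler_norm_sum.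
(* Walks of length two from [z], regrouped by their last vertex after
   dropping the condition on their first step. *)
have walk : a ^+ 2 <= \sum_u (degree u)%:R * `|x u|.
  have -> : a ^+ 2 = a * (a * `|x z|) by rewrite xz; ring.
  apply: le_trans (ler_wpM2l a0 (step z)) _; rewrite mulr_sumr.
  apply: le_trans (ler_sum _ (fun w _ => step w)) _.
  rewrite big_mkcond /=.
  apply: (@le_trans _ _ (\sum_w \sum_(u | sedge w u) `|x u|)).
    by apply: ler_sum => w _; case: ifP => // _; rewrite sumr_ge0.
  rewrite (exchange_big_dep predT) //=; apply: ler_sum => u _.
  rewrite sumr_const mulr_natl /degree.
  suff -> : #|[pred w | sedge w u]| = #|[set w | sedge u w]| by [].
  by apply: eq_card => w; rewrite !inE sedge_sym.
pose L := [set u | (4 * d)^-1 <= `|x u|].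
pose l : R := #|L|%:R.
have l0 : 0 <= l by rewrite ler0n.
(* Every vertex of [L] has degree at least [a / (4 * d)]. *)
have largeL : (4 * d)^-1 * (a * l) <= 2 * d * N.
  have -> : (4 * d)^-1 * (a * l) = \sum_(u in L) a * (4 * d)^-1.
    by rewrite sumr_const -mulr_natr -/l; ring.
  apply: (@le_trans _ _ (\sum_(u in L) (degree u)%:R)).
    apply: ler_sum => u; rewrite inE => uL.
    apply: le_trans (ler_wpM2l a0 uL) (le_trans (step u) _).
    apply: le_trans (ler_sum _ (fun w _ => x1 w)) _.
    by rewrite sumr_const /degree cardsE.
  rewrite -natr_sum -!natrM ler_nat; apply: leq_trans sumdeg.
  by rewrite [X in (_ <= X)%N](bigID (mem L)) leq_addr.
have split_sum : \sum_u (degree u)%:R * `|x u| <=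
    m%:R * N + 3 * d * l + (4 * d)^-1 * (2 * d * N).
  rewrite (bigID (mem L)) /=; apply: lerD.
    apply: (@le_trans _ _ (\sum_(u in L) (degree u)%:R)).
      by apply: ler_sum => u _; rewrite ler_piMr.
    by rewrite -natr_sum -!natrM -natrD ler_nat.
  apply: (@le_trans _ _ (\sum_(u | u \notin L) (degree u)%:R * (4 * d)^-1)).
    by apply: ler_sum => u; rewrite inE -ltNge => /ltW uL; rewrite ler_wpM2l.
  rewrite -mulr_suml mulrC ler_wpM2l ?invr_ge0 ?mulr_ge0 ?(ltW d0) //.
  rewrite -natr_sum -!natrM ler_nat; apply: leq_trans sumdeg.
  by rewrite [X in (_ <= X)%N](bigID (mem L)) leq_addl.
have halfN : (4 * d)^-1 * (2 * d * N) = N / 2.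
  by field; rewrite gt_eqF.
have dl : 12 * d * l <= N.
  have al : a * l <= 8 * d ^+ 2 * N.
    move: largeL; rewrite ler_pdivrMl ?mulr_gt0 // => h; apply: le_trans h _.
    by rewrite le_eqVlt; apply/orP; left; apply/eqP; ring.
  have dal : 96 * d ^+ 3 * l <= a * l by rewrite ler_wpM2r.
  have d2 : 0 < 8 * d ^+ 2 by rewrite mulr_gt0 ?exprn_gt0.
  rewrite -(ler_pM2l d2); apply: le_trans al; apply: le_trans dal.
  by rewrite le_eqVlt; apply/orP; left; apply/eqP; ring.
rewrite -/N; move: walk split_sum; rewrite halfN; lra.
Qed.

Local Close Scope ring_scope.

Theorem corollary1p4 (R : realType) (k : nat) (S : sgraph) (c : S) (r s : nat) :
  2 <= k ->
  #|S| = 2 * k + 2 ->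
  is_spider S ->
  is_center c ->
  num_odd_legs c = r ->
  num_legs_of_length c 1 = s ->
  2 <= r ->
  2 * s - r >= 1 ->
  exists n0 : nat, forall n : nat, n0 <= n ->
    forall G : sgraph, #|G| = n ->
      (spectral_radius R (Snk n k) <= spectral_radius R G)%R ->
      contains_subgraph G S.
Proof.
move=> k2 cardS spS ctr odds _ r2 _.
have [par [depth root]] := tree_rooting c spS.1.
have even_small : #|[set v | ~~ odd (depth v)]| <= k.-1.+1.
  have := odd_level_large root ctr.
  have := cardsC [set v | odd (depth v)].
  have -> : ~: [set v | odd (depth v)] = [set v | ~~ odd (depth v)].
    by apply/setP => v; rewrite !inE.
  by rewrite odds cardS; lia.
pose M := 96 * #|S| ^ 3.
(* [M ^ 2 <= n] makes the eigenvalues below [M] harmless, and [4 * k ^ 2 < n]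
   is the condition for [(k - 1/4) * n < k * (n - k)]. *)
exists (M ^ 2 + 4 * k ^ 2 + 1) => n len G cardG mu; apply: contrapT => free.
have [l l0 [lsq lmu]] : exists2 l : R, (0 <= l)%R &
    (k%:R * (n - k)%:R <= l ^+ 2)%R /\ (l <= spectral_radius R (Snk n k))%R.
  by apply: spectral_radius_Snk; nia.
pose B : R := ((k.-1%:R + 3 / 4) * n%:R)%R.
have kR : (k%:R = k.-1%:R + 1 :> R)%R by rewrite natr1 prednK //; lia.
have k1R : (1 <= k.-1%:R :> R)%R by rewrite ler1n; lia.
have n0R : (0 <= n%:R :> R)%R by rewrite ler0n.
have B0 : (0 <= B)%R by rewrite mulr_ge0 // addr_ge0 // ?divr_ge0 //; lra.
have Bl : (B < l ^+ 2)%R.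
  apply: lt_le_trans lsq; rewrite natrB; last by nia.
  have : (4 * k ^ 2 < n)%N by lia.
  rewrite -(ltr_nat R) natrM natrX /B kR; nra.
have MB : (M%:R ^+ 2 <= B)%R.
  have : (M ^ 2 <= n)%N by lia.
  rewrite -(ler_nat R) natrX /B; nra.
have rootB : (Num.sqrt B < l)%R.
  by rewrite -(ltr_pXn2r (n := 2)) ?nnegrE ?sqrtr_ge0 // sqr_sqrtr.
suff : (spectral_radius R G <= Num.sqrt B)%R.
  by move/(le_trans mu)/(le_trans lmu); rewrite leNgt rootB.
apply: spectral_radius_le => [|a aG]; first exact: sqrtr_ge0.
have M0 : (0 <= M%:R :> R)%R by rewrite ler0n.
have [aM|Ma] := leP a (M%:R)%R.
  apply: le_trans aM _.
  by rewrite -(ler_pXn2r (n := 2)) ?nnegrE ?sqrtr_ge0 // sqr_sqrtr.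
rewrite -(ler_pXn2r (n := 2)) ?nnegrE ?sqrtr_ge0 ?(le_trans M0 (ltW Ma)) //.
rewrite sqr_sqrtr // /B -cardG.
have S0 : 0 < #|S| by rewrite cardS; lia.
apply: (sparse_eigenvalue_bound S0 _ _ aG).
- have := @free_edge_bound S G c par depth #|S| setT setT root free.
  rewrite !cardsT => /(_ (or_introl (leqnSn _))).
  have -> : \sum_(x in [set: G]) #|nbrs x setT| = \sum_(x : G) degree x.
    apply: eq_big => [x|x _]; first by rewrite inE.
    by congr #|pred_of_set _|; apply/setP => y; rewrite !inE.
  by lia.
- by move=> L; apply: (free_degree_sum L root free even_small).
- by move: Ma; rewrite /M natrM natrX => /ltW.
Qed.
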